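(* Assume that all dependencies are known ($U=\emptyset$) and that the repository, with $n$ packages, contains at most $d$ defects and at most $c$ weak conflicts. There exists a non-adaptive algorithm that solves Full Learning using $\mathcal S_{n,d+c,2}=(d+c)^{3+o(1)}\log n$ queries.
   Context: A repository consists of a finite set $P$ of $n$ packages, a set $K\subseteq P\times P$ of known dependencies, a set $U\subseteq P\times P$ of unknown dependencies, a set $C$ of unknown conflicts (unordered pairs of distinct packages), and a set $D\subseteq P$ of defects. A pair $(q,p)\in K\cup U$ means that $q$ depends on $p$: any installation including $q$ but not $p$ fails. The digraph $(P,K)$ is acyclic. An installation is a subset $I\subseteq P$; it is successful iff it contains no defect, contains $p$ whenever it contains $q$ with $(q,p)\in K\cup U$, and contains no two packages $p,q$ with $\{p,q\}\in C$. Defects are the packages that cannot be part of any successful installation; thus a package that depends on a defect is itself a defect, i.e. $((P\setminus D)\times D)\cap(K\cup U)=\emptyset$. Given two packages $p,q\in P$, $p$ weakly conflicts with $q$ if no successful installation includes both $p$ and $q$. An algorithm is given $P$, $K$ and the bounds $d,c$. A query is an installation $I\subseteq P$; an oracle answers whether it is successful. A non-adaptive algorithm computes its whole set of queries from its input and then computes its output from the answers. The cost is the number of queries. Full Learning: return the mixed graph whose vertices are the strongly connected components of the packages with the defective packages marked, together with all conflicts (here understood as weak conflicts) and all dependencies. With all dependencies known, this amounts to determining the defects and the pairs of packages that weakly conflict. An $(n,a,b)$-cover-free family (CFF) is a set $\mathcal F\subseteq\{0,1\}^n$ such that for all disjoint $S_1,S_2\subseteq\{1,\dots,n\}$ with $|S_1|=a$,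 $|S_2|=b$ there is $v\in\mathcal F$ whose entries are all $0$ on $S_1$ and all $1$ on $S_2$. $\mathcal S_{n,a,b}$ denotes the minimal size of an $(n,a,b)$-CFF. The expression $(d+c)^{3+o(1)}\log n$ is the known upper bound on $\mathcal S_{n,d+c,2}$, with $o(1)$ as $d+c\to\infty$.
   Formalization: The query count S_{n,d+c,2} is asserted only for n ≥ d+c+2; for smaller n the cover-free condition is vacuous, S is 0, and the claim fails (n=d=1, c=0). There, learning still succeeds, with the (d+c)^{3+o(1)} log n bound for n ≥ 2. *)

(* Defs.v *)
From mathcomp Require Import all_boot.

Set Implicit Arguments.
Unset Strict Implicit.
Unset Printing Implicit Defensive.

Section CoverFreeFamilies.
Variable n : nat.

Definition cover_free (a b : nat) (F : {set {ffun 'I_n -> bool}}) : bool :=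
  [forall S1 : {set 'I_n}, forall S2 : {set 'I_n},
    [&& [disjoint S1 & S2], #|S1| == a & #|S2| == b] ==>
    [exists v in F, [forall i in S1, v i == false]
                 && [forall i in S2, v i == true]]].

Lemma cover_free_setT (a b : nat) : cover_free a b [set: {ffun 'I_n -> bool}].
Proof.
apply/forallP => S1; apply/forallP => S2; apply/implyP => /and3P[dis _ _].
apply/existsP; exists [ffun i => i \in S2]; rewrite inE /=.
apply/andP; split; apply/forallP => i; apply/implyP => iS; rewrite ffunE.
  by rewrite (disjointFr dis iS).
by rewrite iS.
Qed.

(* The whole cube satisfies cover_free by cover_free_setT, so the minimum     *)
(* ranges over a nonempty collection; it is 0 when n < a + b.                 *)
Definition cff_number (a b : nat) : nat :=
  #|[arg min_(F < [set: {ffun 'I_n -> bool}] | cover_free a b F) #|F| ]|.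

End CoverFreeFamilies.

Definition acyclic (P : finType) (K : {set P * P}) : Prop :=
  forall s : seq P, s != [::] -> ~~ cycle (fun q p => (q, p) \in K) s.

(* D : defects, E : dependencies, a pair (q, p) meaning that q depends on p.  *)
Definition success (P : finType) (E : {set P * P}) (C : {set {set P}})
    (D : {set P}) (I : {set P}) : bool :=
  [&& [disjoint I & D],
      [forall e in E, (e.1 \in I) ==> (e.2 \in I)]
    & [forall e in C, ~~ (e \subset I)]].

Record repository (P : finType) := Repository {
  known : {set P * P};
  unknown : {set P * P};
  conflicts : {set {set P}};
  defects : {set P};
  known_acyclic : acyclic known;
  conflicts_pairs : forall e : {set P}, e \in conflicts -> #|e| = 2;
  defectsP : forall p : P, (p \in defects) =
    ~~ [exists I : {set P},
          success (known :|: unknown) conflicts defects I && (p \in I)]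
}.

Section Repository.
Variables (P : finType) (r : repository P).

Definition dependencies : {set P * P} := known r :|: unknown r.

Definition successful (I : {set P}) : bool :=
  success dependencies (conflicts r) (defects r) I.

Definition weakly_conflicts (p q : P) : bool :=
  ~~ [exists I : {set P}, [&& successful I, p \in I & q \in I]].

(* A defect weakly conflicts with every package, so a single defect already   *)
(* yields n - 1 weakly conflicting pairs.  When weak conflicts are counted,   *)
(* only pairs of non-defective packages are considered.                       *)
Definition weak_conflicts : {set {set P}} :=
  [set [set x.1; x.2] | x : P * P &
    [&& x.1 \notin defects r, x.2 \notin defects r, x.1 != x.2
      & weakly_conflicts x.1 x.2]].

Definition depends : rel P := fun q p => (q, p) \in dependencies.

Definition component (p : P) : {set P} :=
  [set q | connect depends p q && connect depends q p].

Definition components : {set {set P}} := [set component p | p : P].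

End Repository.

Record mixed_graph (P : finType) := MixedGraph {
  vertices : {set {set P}};
  marked : {set {set P}};
  arcs : {set {set P} * {set P}};
  edges : {set {set {set P}}}
}.

(* The packages of a component belong to the same successful installations,   *)
(* so they are all defective or all non-defective, and weak conflict does not *)
(* depend on the representatives.                                             *)
Definition full_learning (P : finType) (r : repository P) : mixed_graph P :=
  {| vertices := components r;
     marked := [set component r p | p in defects r];
     arcs := [set x | [&& x.1 \in components r, x.2 \in components r,
                x.1 != x.2 &
                [exists q in x.1, exists p in x.2, depends r q p]]];
     edges := [set [set x.1; x.2] | x : {set P} * {set P} &
                [&& x.1 \in components r, x.2 \in components r, x.1 != x.2 &
                 [exists p in x.1, exists q in x.2, weakly_conflicts r p q]]]
  |}.

Record nonadaptive_algorithm := NonadaptiveAlgorithm {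
  queries : forall P : finType, {set P * P} -> nat -> nat -> seq {set P};
  output : forall P : finType,
    {set P * P} -> nat -> nat -> seq bool -> mixed_graph P
}.

Definition cost (A : nonadaptive_algorithm) (P : finType) (K : {set P * P})
  (d c : nat) : nat := size (queries A K d c).

Definition solves_full_learning (A : nonadaptive_algorithm) (P : finType)
    (K : {set P * P}) (d c : nat) : Prop :=
  forall r : repository P,
    known r = K -> unknown r = set0 ->
    #|defects r| <= d -> #|weak_conflicts r| <= c ->
    output A K d c (map (successful r) (queries A K d c))
      = full_learning r.

(* Main.v *)
Require Import Defs.
From mathcomp Require Import all_boot zify.

(* A package pair does not weakly conflict iff some successful installation
   contains it, so it suffices to query, for every such pair {p, q}, one
   successful installation containing it.  The dependency closure of a set in
   which no two packages (equal or not) weakly conflict is successful; hence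
   it is enough that the support of a vector contains p and q and avoids the
   defects and one package, other than p and q, of each weak conflict: at most
   d + c packages, which is what a cover-free family provides.
   For the size, colour the n points with 2k colours and keep one colour
   class: it separates a given pair (S1, S2) with frequency at least
   1 / (8 k^2), so covering the at most n^(k+2) pairs greedily takes
   O(k^3 log n) vectors, and the constant is absorbed in k^o(1). *)

Set Implicit Arguments.
Unset Strict Implicit.
Unset Printing Implicit Defensive.

(** * Cover-free families *)

Lemma cover_freeP n a b (F : {set {ffun 'I_n -> bool}}) :
  reflect (forall S1 S2 : {set 'I_n}, [disjoint S1 & S2] ->
             #|S1| = a -> #|S2| = b ->
             exists2 v, v \in F &
               {in S1, forall i, v i = false} /\ {in S2, forall i, v i = true})
          (cover_free a b F).
Proof.
apply: (iffP forallP) => [cfF S1 S2 dis c1 c2 | cfF S1].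
  have /forallP/(_ S2) := cfF S1; rewrite dis c1 c2 !eqxx /= => /existsP[v].
  case/and3P=> vF /forall_inP v0 /forall_inP v1.
  by exists v => //; split=> i iS; apply/eqP; [apply: v0 | apply: v1].
apply/forallP=> S2; apply/implyP=> /and3P[dis /eqP c1 /eqP c2].
have [v vF [v0 v1]] := cfF _ _ dis c1 c2.
apply/existsP; exists v; rewrite vF /=.
by apply/andP; split; apply/forall_inP=> i iS; apply/eqP;
  [apply: v0 | apply: v1].
Qed.

Definition min_cff n a b : {set {ffun 'I_n -> bool}} :=
  [arg min_(F < [set: {ffun 'I_n -> bool}] | cover_free a b F) #|F| ].

Lemma min_cff_cover_free n a b : cover_free a b (min_cff n a b).
Proof.
by rewrite /min_cff; case: arg_minnP => //; apply: cover_free_setT.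
Qed.

Lemma cff_number_le n a b (F : {set {ffun 'I_n -> bool}}) :
  cover_free a b F -> cff_number n a b <= #|F|.
Proof.
rewrite /cff_number; case: arg_minnP => [|G _ minG cfF].
  exact: cover_free_setT.
exact: minG.
Qed.

Lemma cff_number_small n a b : n < a + b -> cff_number n a b = 0.
Proof.
move=> lt_n; apply/eqP; rewrite -leqn0 -(@cards0 {ffun 'I_n -> bool}).
apply/cff_number_le/cover_freeP=> S1 S2 dis c1 c2.
have := max_card (S1 :|: S2); rewrite card_ord cardsU c1 c2.
by rewrite (disjoint_setI0 dis) cards0 subn0 leqNgt lt_n.
Qed.

Lemma subset_card_between (T : finType) (A B : {set T}) m :
  A \subset B -> #|A| <= m <= #|B| ->
  exists S : {set T}, [/\ A \subset S, S \subset B & #|S| = m].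
Proof.
move=> sAB /andP[+ lemB]; elim: m lemB => [|m IHm] ltmB leAm.
  by exists A; split=> //; apply/eqP; rewrite -leqn0.
have [leAm' | ltmA] := leqP #|A| m; last first.
  by exists A; split=> //; apply/eqP; rewrite eqn_leq leAm.
have [S [sAS sSB cS]] := IHm (ltnW ltmB) leAm'.
have /properP[_ [x xB xS]] : S \proper B by rewrite properEcard sSB cS.
exists (x |: S); split; last by rewrite cardsU1 xS cS.
  exact: subset_trans sAS (subsetUr _ _).
by rewrite subUset sub1set xB.
Qed.

(** Needed because only upper bounds on the numbers of defects and conflicts are given, and {p, q}
    is a singleton when p = q. Both sets are padded to exact size, [S1] outside [S2], then [S2]
    outside the enlarged [S1]; [a + b <= n] leaves enough room. *)
Lemma cover_free_le n a b (F : {set {ffun 'I_n -> bool}}) (S1 S2 : {set 'I_n}) :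
  cover_free a b F -> a + b <= n -> [disjoint S1 & S2] ->
  #|S1| <= a -> #|S2| <= b ->
  exists2 v, v \in F &
    {in S1, forall i, v i = false} /\ {in S2, forall i, v i = true}.
Proof.
move=> /cover_freeP cfF le_n dis le1 le2.
have := @subset_card_between _ S1 (~: S2) a.
rewrite -disjoints_subset => /(_ dis)[|T1 [sT1 T1S2 cT1]].
  rewrite le1 -(leq_add2l #|S2|) cardsC card_ord (leq_trans _ le_n) //.
  by rewrite addnC leq_add2l.
have := @subset_card_between _ S2 (~: T1) b.
rewrite subsetC => /(_ T1S2)[|T2 [sT2 T2T1 cT2]].
  by rewrite le2 -(leq_add2l #|T1|) cardsC card_ord cT1.
have [|v vF [v0 v1]] := cfF T1 T2 _ cT1 cT2.
  by rewrite disjoint_sym disjoints_subset.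
exists v => //; split=> i iS; [apply: v0 | apply: v1].
  exact: subsetP sT1 i iS.
exact: subsetP sT2 i iS.
Qed.

(** * Upper bound on the size of a minimal family *)

(* Greedy covering: by double counting some x covers a proportion 1/w of the  *)
(* part of A that is still uncovered.                                         *)
Lemma greedy_cover (X T : finType) (G : X -> T -> bool) (w : nat) (A : {set T}) :
  0 < #|X| -> {in A, forall t, #|X| <= w * #|[set x | G x t]|} ->
  forall m, exists2 F : {set X}, #|F| <= m &
    w ^ m * #|[set t in A | [forall x in F, ~~ G x t]]| <= w.-1 ^ m * #|A|.
Proof.
move=> X0 wA; elim=> [|m [F leF covF]].
  exists set0; rewrite ?cards0 // !expn0 !mul1n subset_leq_card //.
  by apply/subsetP=> t; rewrite inE => /andP[].
set B := [set t in A | _] in covF.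
have [x lex] : exists x, #|B| <= w * #|[set t in B | G x t]|.
  apply/existsP; apply: contraT; rewrite negb_exists => /forallP ltB.
  have : \sum_(t in B) #|X| <= \sum_(t in B) w * #|[set x | G x t]|.
    by apply: leq_sum => t; rewrite inE => /andP[/wA].
  rewrite sum_nat_const -big_distrr /=.
  under eq_bigr do rewrite -sum1dep_card.
  rewrite (exchange_big_dep xpredT) //= big_distrr /=.
  under eq_bigr do rewrite sum1dep_card.
  suff lt : \sum_(x : X) w * #|[set t in B | G x t]| < \sum_(x : X) #|B|.
    rewrite sum_nat_const mulnC in lt.
    by move/leq_ltn_trans/(_ lt); rewrite ltnn.
  (* The strict inequality between the sums needs at least one index. *)
  have /card_gt0P[x0 _] := X0.
  rewrite (bigD1 x0) // [X in _ < X](bigD1 x0) //=.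
  rewrite -addSn leq_add //; first by rewrite ltnNge ltB.
  by apply: leq_sum => x _; apply: ltnW; rewrite ltnNge ltB.
exists (x |: F); first by rewrite cardsU1; case: (x \in F) => /=; lia.
set B' := [set t in A | _].
have sB' : B' = B :\: [set t in B | G x t].
  apply/setP=> t; rewrite !inE; case: (t \in A) => //=.
  apply/forall_inP/andP=> [nG | [+ /forall_inP nG] y].
    rewrite negb_and nG ?setU11 // orbT; split=> //; apply/forall_inP=> y yF.
    by rewrite nG // setU1r.
  rewrite (introT forall_inP nG) /= => nGx.
  by case/setU1P=> [->|/nG].
have cB' : #|B'| = #|B| - #|[set t in B | G x t]|.
  by rewrite sB' cardsD (setIidPr _) //; apply/subsetP=> t; rewrite inE => /andP[].
have leB' : w * #|B'| <= w.-1 * #|B| by rewrite cB'; nia.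
rewrite !expnSr -mulnA (leq_trans (leq_mul (leqnn _) leB')) //.
by rewrite mulnCA [_ ^ m * w.-1]mulnC -mulnA leq_mul2l covF orbT.
Qed.

(* Colour 'I_n with N.+1 colours and keep the colour 0: a given colouring     *)
(* separates a given pair (S1, S2) with frequency N^a / N.+1^(a + b).         *)
Lemma card_separating_colourings n N a b (S1 S2 : {set 'I_n}) :
  [disjoint S1 & S2] -> #|S1| = a -> #|S2| = b ->
  N.+1 ^ (a + b) * #|[set g : {ffun 'I_n -> 'I_N.+1} |
      [forall i in S1, g i != ord0] && [forall i in S2, g i == ord0]]|
    = N ^ a * #|{ffun 'I_n -> 'I_N.+1}|.
Proof.
move=> dis c1 c2.
pose Fam (i : 'I_n) : pred 'I_N.+1 :=
  if i \in S1 then predC1 ord0 else if i \in S2 then pred1 ord0 else predT.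
have -> : #|[set g : {ffun 'I_n -> 'I_N.+1} |
    [forall i in S1, g i != ord0] && [forall i in S2, g i == ord0]]| = #|family Fam|.
  apply: eq_card => g; rewrite inE.
  apply/andP/familyP=> [[/forall_inP g1 /forall_inP g2] i | gF].
    by rewrite /Fam; case: ifP => [/g1//|_]; case: ifP => [/g2|].
  split; apply/forall_inP=> i iS; move: (gF i); rewrite /Fam ?iS //.
  by rewrite (disjointFl dis iS).
rewrite card_family foldrE big_map big_enum /= card_ffun !card_ord.
rewrite (bigID (mem S1)) /= (eq_bigr (fun=> N)); last first.
  by move=> i iS; rewrite /Fam iS cardC1 card_ord.
rewrite prod_nat_const c1 (bigID (mem S2)) /= big1 ?mul1n; last first.
  by move=> i /andP[i1 i2]; rewrite /Fam (negbTE i1) i2 card1.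
rewrite (eq_bigr (fun=> N.+1)); last first.
  by move=> i /andP[/negbTE i1 /negbTE i2]; rewrite /Fam i1 i2 card_ord.
rewrite (eq_bigl [in ~: (S1 :|: S2)]) => [|i]; last by rewrite !inE negb_or.
rewrite prod_nat_const mulnCA -expnD -c1 -c2; congr (_ * _ ^ _).
have <- : #|S1 :|: S2| = #|S1| + #|S2|.
  by rewrite cardsU (disjoint_setI0 dis) cards0 subn0.
by rewrite cardsC card_ord.
Qed.

(** Every pair is separated by a proportion at least 1/w of the colourings and there are at most
    n^(a + b) pairs, so after m greedy choices fewer than one pair is uncovered. *)
Lemma cff_number_greedy n a b N w m :
  0 < n -> N.+1 ^ (a + b) <= w * N ^ a -> w.-1 ^ m * n ^ (a + b) < w ^ m ->
  cff_number n a b <= m.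
Proof.
move=> n0 lew ltm.
pose A := [set S : {set 'I_n} * {set 'I_n} |
  [&& [disjoint S.1 & S.2], #|S.1| == a & #|S.2| == b]].
pose G (g : {ffun 'I_n -> 'I_N.+1}) (S : {set 'I_n} * {set 'I_n}) :=
  [forall i in S.1, g i != ord0] && [forall i in S.2, g i == ord0].
have leA : #|A| <= n ^ (a + b).
  pose D c := [set S : {set 'I_n} | #|S| == c].
  have leD c : #|D c| <= n ^ c.
    have := card_draws 'I_n c; rewrite card_ord => ->.
    rewrite -(leq_pmul2r (fact_gt0 c)) bin_ffact.
    elim: c => [|c IHc]; first by rewrite ffactn0.
    rewrite ffactnSr expnSr factS; have := fact_gt0 c; nia.
  rewrite expnD (leq_trans _ (leq_mul (leD a) (leD b))) // -cardsX.
  by apply/subset_leq_card/subsetP=> S; rewrite !inE => /andP[_].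
have [||F leF] := @greedy_cover _ _ G w A _ _ m.
- by rewrite card_ffun !card_ord expn_gt0.
- move=> S; rewrite inE => /and3P[dis /eqP c1 /eqP c2].
  have card_gt : 0 < N.+1 ^ (a + b) by rewrite expn_gt0.
  rewrite -(leq_pmul2l card_gt) mulnCA (card_separating_colourings N dis c1 c2).
  by rewrite mulnA leq_mul2r lew orbT.
set B := [set t in A | _] => leB.
have B0 : B = set0.
  apply/eqP; rewrite -cards_eq0 -leqn0 leqNgt; apply/negP=> Bgt.
  have := leq_trans (leq_pmulr (w ^ m) Bgt) leB.
  by rewrite leqNgt (leq_ltn_trans _ ltm) // leq_mul2l leA orbT.
pose indicator (g : {ffun 'I_n -> 'I_N.+1}) := [ffun i => g i == ord0].
apply: (leq_trans _ (leq_trans (leq_imset_card indicator F) leF)).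
apply/cff_number_le/cover_freeP=> S1 S2 dis c1 c2.
have : (S1, S2) \notin B by rewrite B0 inE.
rewrite !inE dis c1 c2 !eqxx /= negb_forall_in => /exists_inP[g gF].
rewrite negbK => /andP[/forall_inP /= g1 /forall_inP /= g2].
exists (indicator g); first exact: imset_f.
by split=> i iS; rewrite ffunE; [exact: negbTE (g1 _ iS) | exact: g2].
Qed.

Lemma half_power k : (2 * k) ^ k <= 2 * (2 * k).-1 ^ k.
Proof.
have [->|k0] := posnP k; first by [].
(* Bernoulli's inequality for (1 - 1/N)^j, cleared of denominators. *)
have bernoulli N j : j <= N -> N ^ j * (N - j) <= N * N.-1 ^ j.
  elim: j => [|j IHj] ltjN; first by rewrite subn0 mul1n muln1.
  have {}IHj := IHj (ltnW ltjN); rewrite !expnSr.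
  have : N * (N - j.+1) <= (N - j) * N.-1 by nia.
  nia.
have := bernoulli (2 * k) k; nia.
Qed.

(** With 2k colours, k points all avoid colour 0 with frequency at least 1/2 ([half_power]), and two
    points both receive it with frequency 1/(2k)^2; the product is 1/(8k^2). *)
Lemma cff_number_pairs_le n k m : 0 < n -> 0 < k ->
  (8 * k ^ 2).-1 ^ m * n ^ k.+2 < (8 * k ^ 2) ^ m -> cff_number n k 2 <= m.
Proof.
move=> n0 k0 ltm; apply: (@cff_number_greedy _ _ _ (2 * k).-1 (8 * k ^ 2)) => //.
  rewrite prednK ?muln_gt0 // expnD expnMn.
  by have := half_power k; rewrite expnMn; nia.
by rewrite addn2.
Qed.

(** * Learning from closures *)

Section Learning.
Variable P : finType.
Implicit Types (E K W : {set P * P}) (A I : {set P}) (p q : P).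

Definition closure E A : {set P} :=
  [set p | [exists q in A, connect (fun q p => (q, p) \in E) q p]].

Lemma sub_closure E A : A \subset closure E A.
Proof.
by apply/subsetP=> p pA; rewrite inE; apply/exists_inP; exists p.
Qed.

Definition component_of E p : {set P} :=
  [set q | connect (fun q p => (q, p) \in E) p q
           && connect (fun q p => (q, p) \in E) q p].

(** The output cannot refer to the repository, so the graph is rebuilt from a dependency relation
    [E] and a weak conflict relation [W]. The diagonal of [W] encodes the defects, since a package
    is a defect iff it weakly conflicts with itself. *)
Definition learned_graph E W : mixed_graph P :=
  let comps := [set component_of E p | p : P] in
  {| vertices := comps;
     marked := [set component_of E p | p in [set p | (p, p) \in W]];
     arcs := [set x | [&& x.1 \in comps, x.2 \in comps, x.1 != x.2 &
                [exists q in x.1, exists p in x.2, (q, p) \in E]]];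
     edges := [set [set x.1; x.2] | x : {set P} * {set P} &
                [&& x.1 \in comps, x.2 \in comps, x.1 != x.2 &
                 [exists p in x.1, exists q in x.2, (p, q) \in W]]]
  |}.

Definition unanswered (Q : seq {set P}) (ans : seq bool) : {set P * P} :=
  [set x | ~~ has (fun u : {set P} * bool =>
                     [&& u.2, x.1 \in u.1 & x.2 \in u.1]) (zip Q ans)].

Variable r : repository P.

Lemma successfulP I :
  reflect [/\ forall p, p \in I -> p \notin defects r,
              forall q p, (q, p) \in dependencies r -> q \in I -> p \in I
            & forall e, e \in conflicts r -> ~~ (e \subset I)]
          (successful r I).
Proof.
apply: (iffP and3P) => [[dis /forall_inP dep /forall_inP conf]|[dis dep conf]].
  split=> // [p pI|q p qp qI]; first by rewrite (disjointFr dis pI).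
  by have /implyP := dep _ qp; apply.
split; last exact/forall_inP.
  by rewrite disjoints_subset; apply/subsetP=> p pI; rewrite inE dis.
by apply/forall_inP=> -[q p] qp; apply/implyP; apply: dep qp.
Qed.

Lemma closure_sub A I :
  successful r I -> A \subset I -> closure (dependencies r) A \subset I.
Proof.
case/successfulP=> _ dep _ /subsetP sAI; apply/subsetP=> p.
rewrite inE => /exists_inP[q /sAI qI /connectP[s]].
elim: s q qI => [|q' s IHs] q qI /=; first by move=> _ ->.
by case/andP=> qq'; apply: IHs; apply: dep qq' qI.
Qed.

Lemma not_weakly_conflictsP p q :
  reflect (exists2 I, successful r I & p \in I /\ q \in I)
          (~~ weakly_conflicts r p q).
Proof.
rewrite negbK; apply: (iffP existsP) => [[I /and3P[]] | [I sI [pI qI]]].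
  by exists I.
by exists I; rewrite sI pI.
Qed.

Lemma weakly_conflicts_sym p q :
  weakly_conflicts r p q = weakly_conflicts r q p.
Proof.
by congr (~~ _); apply: eq_existsb => I; rewrite [(p \in I) && _]andbC.
Qed.

Lemma weakly_conflicts_defect p : weakly_conflicts r p p = (p \in defects r).
Proof.
by rewrite defectsP; congr (~~ _); apply: eq_existsb => I; rewrite andbb.
Qed.

(** Any two packages of the closure are reached from some p, q in [A]; a successful installation
    containing p and q is closed under dependencies, hence contains both. A defect or a conflict
    involves at most two packages, so neither can occur. *)
Lemma closure_successful A :
  {in A &, forall p q, ~~ weakly_conflicts r p q} ->
  successful r (closure (dependencies r) A).
Proof.
move=> okA.
have pair_closure x y : x \in closure (dependencies r) A ->
    y \in closure (dependencies r) A ->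
    exists2 I, successful r I & x \in I /\ y \in I.
  rewrite !inE => /exists_inP[p pA px] /exists_inP[q qA qy].
  have /not_weakly_conflictsP[I sI [pI qI]] := okA p q pA qA.
  have : [set p; q] \subset I by rewrite subUset !sub1set pI.
  move/(closure_sub sI)/subsetP=> sub; exists I => //.
  by split; apply: sub; rewrite inE; apply/exists_inP;
     [exists p | exists q]; rewrite // !inE eqxx ?orbT.
apply/successfulP; split=> [p pA | q p qp | e eC].
- have [I /successfulP[noD _ _] [pI _]] := pair_closure p p pA pA.
  exact: noD.
- rewrite !inE => /exists_inP[x xA xq]; apply/exists_inP; exists x => //.
  exact: connect_trans xq (connect1 qp).
have /eqP/cards2P[x [y [_ def_e]]] := conflicts_pairs eC.
apply/negP; rewrite def_e subUset !sub1set => /andP[xA yA].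
have [I /successfulP[_ _ noC] [xI yI]] := pair_closure x y xA yA.
by have := noC e eC; rewrite def_e subUset !sub1set xI yI.
Qed.

Lemma full_learningE :
  full_learning r =
    learned_graph (dependencies r) [set x | weakly_conflicts r x.1 x.2].
Proof.
set W := [set x | _].
have defD : [set p | (p, p) \in W] = defects r.
  by apply/setP=> p; rewrite !inE weakly_conflicts_defect.
rewrite /learned_graph defD; congr MixedGraph.
have memW (X Y : {set P}) :
    [exists p in X, exists q in Y, (p, q) \in W]
    = [exists p in X, exists q in Y, weakly_conflicts r p q].
  by apply: eq_existsb => p; congr (_ && _); apply: eq_existsb => q; rewrite inE.
by apply/setP=> e; apply/imsetP/imsetP=> -[x xW ->]; exists x;
  move: xW; rewrite ?inE ?memW.
Qed.

(** A positive answer is itself a witness that its pairs do not weakly conflict; the hypothesis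
    supplies the converse. *)
Lemma unanswered_weakly_conflicts (Q : seq {set P}) :
  (forall p q, ~~ weakly_conflicts r p q ->
     exists2 I, I \in Q & [/\ successful r I, p \in I & q \in I]) ->
  unanswered Q (map (successful r) Q)
    = [set x | weakly_conflicts r x.1 x.2].
Proof.
move=> covQ; apply/setP=> -[p q]; rewrite !inE /=; apply: negb_inj.
rewrite negbK -{1}[Q]map_id zip_map has_map.
apply/hasP/not_weakly_conflictsP => [[I _ /and3P[sI pI qI]]|[I sI [pI qI]]].
  by exists I.
have [|J JQ [sJ pJ qJ]] := covQ p q; first by apply/not_weakly_conflictsP; exists I.
by exists J => //=; rewrite sJ pJ.
Qed.

End Learning.

(** * The algorithm, its correctness and its cost *)

Definition support (P : finType) (v : {ffun 'I_#|P| -> bool}) : {set P} :=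
  [set p | v (enum_rank p)].

(* For #|P| < d + c + 2 the cover-free condition is vacuous and the empty     *)
(* family is minimal; the closures of all pairs are queried instead.          *)
Definition cff_queries (P : finType) (K : {set P * P}) (d c : nat) :
    seq {set P} :=
  if (d + c).+2 <= #|P|
  then [seq closure K (support v) | v in min_cff #|P| (d + c) 2]
  else [seq closure K [set x.1; x.2] | x : P * P].

Definition cff_algorithm : nonadaptive_algorithm :=
  {| queries := cff_queries;
     output P K d c ans := learned_graph K (unanswered (cff_queries K d c) ans)
  |}.

Lemma support_separating (P : finType) (r : repository P) (d c : nat) p q :
  #|defects r| <= d -> #|weak_conflicts r| <= c -> (d + c).+2 <= #|P| ->
  ~~ weakly_conflicts r p q ->
  exists2 v, v \in min_cff #|P| (d + c) 2 &
    [/\ p \in support v, q \in support v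
      & {in support v &, forall x y, ~~ weakly_conflicts r x y}].
Proof.
move=> led lec leP npq.
have /not_weakly_conflictsP[I sI [pI qI]] := npq.
have /successfulP[noD _ _] := sI.
(* The default [p] is never taken on a weak conflict: two distinct packages inside {p, q} would be p
   and q themselves, contradicting [npq]. *)
pose other (e : {set P}) := odflt p [pick x in e :\: [set p; q]].
pose S := defects r :|: [set other e | e in weak_conflicts r].
have otherP e : e \in weak_conflicts r -> other e \in e :\: [set p; q].
  move=> /imsetP[[x y]]; rewrite inE /= => /and4P[_ _ neq xy] ->.
  rewrite /other; case: pickP => //= none.
  have mem z : z \in [set x; y] -> z \in [set p; q].
    by move=> zxy; have /= := none z; rewrite inE zxy andbT => /negbFE.
  have := mem x; have := mem y; rewrite !inE !eqxx orbT /=.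
  move=> /(_ isT)/orP[]/eqP dy /(_ isT)/orP[]/eqP dx; move: neq xy npq;
    by rewrite dx dy ?eqxx // 1?weakly_conflicts_sym => _ ->.
have dis : [disjoint S & [set p; q]].
  rewrite disjoints_subset; apply/subsetP=> x; rewrite in_setC => /setUP[xD|].
    by rewrite !inE negb_or; apply/andP; split; apply: contraL xD => /eqP->;
       apply: noD.
  by case/imsetP=> e /otherP + ->; rewrite inE => /andP[].
have leS : #|S| <= d + c.
  apply: leq_trans (leq_card_setU _ _) (leq_add led _).
  exact: leq_trans (leq_imset_card _ _) lec.
have inj := @enum_rank_inj P.
have [||||v vF [v0 v1]] := @cover_free_le _ _ _ _ (enum_rank @: S)
    (enum_rank @: [set p; q]) (min_cff_cover_free #|P| (d + c) 2).
- by rewrite addn2.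
- by rewrite imset_disjoint //; apply: in2W.
- by rewrite card_imset.
- by rewrite card_imset // cards2; case: (_ == _).
have suppS x : x \in support v -> x \notin S.
  by rewrite inE; apply: contraL => xS; rewrite v0 // imset_f.
exists v => //; split.
- by rewrite inE v1 // imset_f // !inE eqxx.
- by rewrite inE v1 // imset_f // !inE eqxx orbT.
move=> x y /[dup] xv /suppS + /[dup] yv /suppS.
rewrite !inE !negb_or => /andP[xD _] /andP[yD _].
have [<-|neq] := eqVneq x y; first by rewrite weakly_conflicts_defect.
(* Otherwise {x, y} is a counted weak conflict, and its [other] element, x or y, lies both in [S]
   and in the support. *)
apply/negP=> xy.
have e_wc : [set x; y] \in weak_conflicts r.
  by apply/imsetP; exists (x, y); rewrite ?inE //= xD yD neq xy.
have := otherP _ e_wc; rewrite !inE => /andP[_].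
have oS : other [set x; y] \in S by rewrite inE imset_f ?orbT.
by case/orP=> /eqP o; [move: (suppS _ xv) | move: (suppS _ yv)];
   rewrite -o oS.
Qed.

Lemma cff_algorithm_solves (P : finType) (K : {set P * P}) (d c : nat) :
  solves_full_learning cff_algorithm K d c.
Proof.
move=> r rK r0 led lec.
have depK : dependencies r = K by rewrite /dependencies rK r0 setU0.
rewrite full_learningE depK /= unanswered_weakly_conflicts // => p q npq.
rewrite /cff_queries -depK; case: ifP => [leP | _].
  have [v vF [pv qv ok]] := support_separating led lec leP npq.
  exists (closure (dependencies r) (support v)).
    by apply/imageP; exists v.
  split; first exact: closure_successful.
    exact: subsetP (sub_closure _ _) p pv.
  exact: subsetP (sub_closure _ _) q qv.
exists (closure (dependencies r) [set p; q]).
  by apply/imageP; exists (p, q).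
have /not_weakly_conflictsP[I sI [pI qI]] := npq.
split; last first.
- by apply: (subsetP (sub_closure _ _)); rewrite !inE eqxx orbT.
- by apply: (subsetP (sub_closure _ _)); rewrite !inE eqxx.
apply: closure_successful => x y xpq ypq; apply/not_weakly_conflictsP.
exists I => //; move: xpq ypq; rewrite !inE.
by move=> /orP[]/eqP-> /orP[]/eqP->.
Qed.

(** Vectors whose supports have the same closure yield repeated queries, which are kept, so the cost
    is an equality. *)
Lemma cost_cff_algorithm (P : finType) (K : {set P * P}) (d c : nat) :
  cost cff_algorithm K d c =
    if (d + c).+2 <= #|P| then cff_number #|P| (d + c) 2 else #|P| ^ 2.
Proof.
rewrite /cost /= /cff_queries; case: ifP => _; rewrite size_image //.
by rewrite card_prod.
Qed.

From mathcomp Require Import all_order all_algebra ring lra.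
From mathcomp Require Import all_classical all_reals all_analysis.
Import Order.TTheory GRing.Theory Num.Theory.
Import numFieldNormedType.Exports.
Local Open Scope classical_set_scope.
Local Open Scope ring_scope.

(** * Asymptotics *)

Section Asymptotics.
Variable R : realType.

(** From 1 + y <= exp y at y = - ln n: ln n >= 1 - 1/n >= 1/2. This lets additive constants be
    absorbed into ln n. *)
Lemma ln_nat_ge_half (n : nat) : (1 < n)%N -> 2^-1 <= ln (n%:R : R).
Proof.
move=> n1; have n0 : 0 < n%:R :> R by rewrite ltr0n ltnW.
have := expR_ge1Dx (- ln (n%:R : R)); rewrite expRN lnK ?posrE //.
have : n%:R^-1 <= 2^-1 :> R by rewrite lef_pV2 ?posrE // ler_nat.
lra.
Qed.

Lemma cff_number_ln_le (n k : nat) : (1 < k)%N ->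
  (cff_number n k 2)%:R <= 25 * k%:R ^+ 3 * ln (n%:R : R).
Proof.
move=> k1; have [ltn|len] := ltnP n (k + 2).
  (* Only nonnegativity of the logarithm remains; at n = 0 it holds by the convention ln 0 = 0. *)
  rewrite cff_number_small // !mulr_ge0 //.
  case: n ltn => [|n] _; first by rewrite ln0.
  by rewrite ln_ge0 // ler1n.
have n1 : (1 < n)%N by lia.
have L := ln_nat_ge_half n1.
have n0 : 0 < n%:R :> R by rewrite ltr0n; lia.
set l := ln _ in L *.
set w := (8 * k ^ 2)%N.
have w0 : 0 < w%:R :> R by rewrite ltr0n /w; nia.
(* For m > x, (1 - 1/w)^m <= exp(- m/w) < n^-(k + 2). *)
set x : R := w%:R * k.+2%:R * l.
have x0 : 0 <= x by rewrite !mulr_ge0 //; lra.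
have lem : (cff_number n k 2 <= (Num.truncn x).+1)%N.
  apply: cff_number_pairs_le; rewrite ?(ltnW n1) ?(ltnW k1) // -/w.
  have xm : x < (Num.truncn x).+1%:R by apply: truncnS_gt.
  set m := (Num.truncn x).+1 in xm *.
  rewrite -(ltr_nat R) natrM !natrX.
  have w1 : w.-1%:R = w%:R * (1 - w%:R^-1) :> R.
    rewrite -subn1 natrB; last by rewrite -(ltr0n R).
    by field; rewrite gt_eqF.
  have leE : w.-1%:R <= w%:R * expR (- w%:R^-1) :> R.
    by rewrite w1 ler_pM2l // expR_ge1Dx.
  have -> : n%:R = expR l :> R by rewrite /l lnK ?posrE.
  have leM : w.-1%:R ^+ m <= (w%:R * expR (- w%:R^-1)) ^+ m :> R.
    by rewrite lerXn2r // ?nnegrE ?mulr_ge0 ?expR_ge0.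
  apply: le_lt_trans (ler_wpM2r _ leM) _; first by rewrite exprn_ge0 ?expR_ge0.
  rewrite exprMn -mulrA -!expRM_natl -expRD gtr_pMr ?exprn_gt0 //.
  rewrite -[ltRHS]expR0 ltr_expR mulrN addrC subr_lt0.
  by rewrite ltr_pdivlMr // mulrC mulrA.
have : (cff_number n k 2)%:R <= x + 1.
  apply: (@le_trans _ _ (Num.truncn x).+1%:R); first by rewrite ler_nat.
  by rewrite -natr1 lerD2r truncn_le.
move/le_trans; apply.
have k2 : 2 <= k%:R :> R by rewrite ler_nat.
have -> : x = 8 * k%:R ^+ 2 * (k%:R + 2) * l.
  by rewrite /x /w natrM natrX -[k.+2]addn2 natrD.
set a := k%:R in k2 *.
have a3 : 8 <= a ^+ 3.
  by rewrite /a -natrX ler_nat (@leq_exp2r 2 k 3).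
have h1 : 0 <= a ^+ 2 * (a - 2) * l by rewrite !mulr_ge0 ?exprn_ge0 //; lra.
(* Since k + 2 <= 2k, x <= 16 k^3 l; the extra 1 fits in the remaining 9 k^3 l because k^3 >= 8 and
   l >= 1/2. *)
have h2 : 0 <= (a ^+ 3 - 8) * (l - 2^-1) by rewrite mulr_ge0 //; lra.
nra.
Qed.

(** The exponent e solving k^e = 25, which absorbs the constant of [cff_number_ln_le]. *)
Definition cff_exponent (k : nat) : R := ln 25 / ln k%:R.

Lemma powR_cff_exponent (k : nat) : (1 < k)%N ->
  k%:R `^ (3 + cff_exponent k) = 25 * k%:R ^+ 3.
Proof.
move=> k1; have k0 : k%:R != 0 :> R by rewrite pnatr_eq0; lia.
have L := ln_nat_ge_half k1.
rewrite powRD; last by rewrite k0 implybT.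
rewrite powR_mulrn // mulrC {1}/powR (negbTE k0) /cff_exponent divfK ?lnK ?posrE //.
by apply: lt0r_neq0; lra.
Qed.

Lemma cvg_cff_exponent : cff_exponent k @[k --> \oo] --> (0 : R).
Proof.
have ln25 : 0 < ln 25 :> R by apply: ln_gt0; lra.
apply/cvgrPdist_le => e e0; near=> k.
have k1 : (1 < k)%N by near: k; exists 2%N.
have L := ln_nat_ge_half k1.
have kE : expR (ln 25 / e) <= k%:R.
  apply: ltW; apply: lt_le_trans (truncnS_gt _) _; rewrite ler_nat.
  by near: k; exists (Num.truncn (expR (ln 25 / e : R))).+1.
rewrite sub0r normrN ger0_norm ?divr_ge0 ?(ltW ln25) //; last by lra.
rewrite ler_pdivrMr; last by lra.
rewrite mulrC -ler_pdivrMr // -[leLHS]expRK ler_ln ?posrE ?expR_gt0 //.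
by rewrite ltr0n ltnW.
Unshelve. all: by end_near. Qed.

End Asymptotics.

(** The o(1) is [eps], a function of d + c alone. Below d + c + 2 packages [cff_number] is 0 by
    vacuity, so the equality is restricted while the asymptotic bound is not; a single package is
    excluded there because ln 1 = 0. *)
Theorem theorem9 (R : realType) :
  exists (A : nonadaptive_algorithm) (eps : nat -> R) (k0 : nat),
    [/\ eps k @[k --> \oo] --> (0 : R),
        (forall n k : nat, (k0 <= k)%N ->
           (cff_number n k 2)%:R <= k%:R `^ (3 + eps k) * ln (n%:R : R))
      & forall (P : finType) (K : {set P * P}) (d c : nat), acyclic K ->
        [/\ solves_full_learning A K d c,
            ((d + c).+2 <= #|P|)%N -> cost A K d c = cff_number #|P| (d + c) 2
          & (k0 <= d + c)%N -> (1 < #|P|)%N ->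
            (cost A K d c)%:R
              <= (d + c)%:R `^ (3 + eps (d + c)%N) * ln (#|P|%:R : R)]].
Proof.
exists cff_algorithm, (cff_exponent R), 2%N; split.
- exact: cvg_cff_exponent.
- by move=> n k k2; rewrite powR_cff_exponent // cff_number_ln_le.
move=> P K d c _; rewrite cost_cff_algorithm; split.
- exact: cff_algorithm_solves.
- by move=> ->.
move=> k2 P2; rewrite powR_cff_exponent //; case: ifP => [_ | /negbT small].
  exact: cff_number_ln_le.
have := ln_nat_ge_half R P2; set l := ln _ => L.
set k := (d + c)%N in k2 small *.
(* All pairs are queried here, with n <= k + 1, and 8 k^3 <= 16 k^3 l as l >= 1/2. *)
have leP : (#|P| ^ 2 <= 8 * k ^ 3)%N.
  have : (#|P| <= k.+1)%N by rewrite -ltnNge in small.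
  rewrite /leq in k2 *; nia.
rewrite -(ler_nat R) natrM !natrX in leP.
rewrite natrX (le_trans leP) //.
have : 0 <= k%:R ^+ 3 :> R by rewrite exprn_ge0.
nra.
Qed.
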